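(* Let $\Gamma_4^2,\Gamma_4^3,\Gamma_4^4$ be the coefficients, depending on $H$, of the projection $\mathbb{E}(\Delta_1\mid\Delta_2,\Delta_3,\Delta_4)=\Gamma_4^2\Delta_2+\Gamma_4^3\Delta_3+\Gamma_4^4\Delta_4$ for fractional Gaussian noise $(\Delta_k)$ with Hurst index $H$, as defined in the context. Then for any $H\in(\tfrac12,1)$, $$\Gamma_4^2>\Gamma_4^3\quad\text{and}\quad\Gamma_4^4>0.$$
   Context: Let $B^H=\{B^H_t,t\ge0\}$ be a fractional Brownian motion with Hurst index $H$, i.e. a centred Gaussian process with covariance $\tfrac12(t^{2H}+s^{2H}-|t-s|^{2H})$, and let $\Delta_n=B^H_n-B^H_{n-1}$, $n\ge 1$, be its increments (fractional Gaussian noise). They form a stationary Gaussian sequence with autocovariance $\rho_k=\mathbb{E}\Delta_1\Delta_{k+1}=\tfrac12(|k+1|^{2H}-2|k|^{2H}+|k-1|^{2H})$, $k\ge 0$ (so $\rho_0=1$). For $n\ge 2$ the real coefficients $\Gamma_n^k$, $2\le k\le n$, are defined by $\mathbb{E}(\Delta_1\mid\Delta_2,\dots,\Delta_n)=\sum_{k=2}^n\Gamma_n^k\Delta_k$; equivalently, they are the unique solution of the linear system $\rho_{l-1}=\sum_{k=2}^n\Gamma_n^k\rho_{|l-k|}$, $2\le l\le n$ (whose coefficient matrix is nonsingular). *)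

(* Defs.v *)
From HB Require Import structures.
From mathcomp Require Import all_boot all_order all_algebra.
From mathcomp Require Import all_classical all_reals all_analysis.
Set Implicit Arguments.
Unset Strict Implicit.
Unset Printing Implicit Defensive.
Import Order.TTheory GRing.Theory Num.Theory.
Import numFieldNormedType.Exports.
Local Open Scope classical_set_scope.
Local Open Scope ring_scope.

(* [normal_prob m 0] is not the Dirac mass at [m] (the library's density for
   standard deviation 0 is the indicator of [0, 1]), so the degenerate
   Gaussian law is a separate case. *)
Definition gaussian_law (R : realType) (mu : set R -> \bar R) : Prop :=
  exists m s : R, 0 <= s /\
    forall A : set R, measurable A ->
      mu A = if s == 0 then \d_m A else normal_prob m s A.

(* Only the times [0 <= t] are constrained. *)
Definition gaussian_process d (T : measurableType d) (R : realType)
    (P : probability T R) (B : R -> {RV P >-> R}) : Prop :=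
  forall (n : nat) (t c : 'I_n -> R), (forall i, 0 <= t i) ->
    gaussian_law (pushforward P (fun w => \sum_(i < n) c i * B (t i) w)).

Definition fractional_brownian_motion d (T : measurableType d) (R : realType)
    (P : probability T R) (H : R) (B : R -> {RV P >-> R}) : Prop :=
  [/\ 0 < H < 1,
      gaussian_process B,
      (forall t : R, 0 <= t -> ('E_P[B t] = 0)%E) &
      (forall t s : R, 0 <= t -> 0 <= s ->
         covariance P (B t) (B s) =
         (2^-1 * (t `^ (2 * H) + s `^ (2 * H) - `|t - s| `^ (2 * H)))%:E)].

(* Used for [1 <= k]. *)
Definition increment d (T : measurableType d) (R : realType)
    (P : probability T R) (B : R -> {RV P >-> R}) (k : nat) (w : T) : R :=
  B k%:R w - B k.-1%:R w.

(* [Y] is a version of E(X | F); [F] is meant to be a sub-sigma-algebra. *)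
Definition is_conditional_expectation d (T : measurableType d) (R : realType)
    (P : probability T R) (F : set (set T)) (X Y : T -> R) : Prop :=
  [/\ P.-integrable setT (EFin \o X),
      P.-integrable setT (EFin \o Y),
      (forall A : set R, measurable A -> F (Y @^-1` A)) &
      (forall E : set T, F E ->
         (\int[P]_(w in E) (Y w)%:E = \int[P]_(w in E) (X w)%:E)%E)].

(* sigma(Delta_2, ..., Delta_n) *)
Definition sigma_increments d (T : measurableType d) (R : realType)
    (P : probability T R) (B : R -> {RV P >-> R}) (n : nat) : set (set T) :=
  g_sigma_preimage (fun i : 'I_n.-1 => increment B i.+2).

(* [Gamma k] stands for Gamma_n^k; only its values at 2 <= k <= n matter. *)
Definition projection_coefficients d (T : measurableType d) (R : realType)
    (P : probability T R) (B : R -> {RV P >-> R}) (n : nat)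
    (Gamma : nat -> R) : Prop :=
  is_conditional_expectation P (sigma_increments B n) (increment B 1)
    (fun w => \sum_(2 <= k < n.+1) Gamma k * increment B k w).

(* Main.v *)
(**
Testing the projection against the increments, which have finite second moments,
turns the conditional expectation into the normal equations, whose matrix
entries are the autocovariances rho_k.  Put u = 2^(2H), v = 3^(2H),
a = rho_1 = (u - 2)/2, b = rho_2 = (v - 2u + 1)/2 and dl = a - b.  Then
rho_3 = (u^2 - 2v + u)/2 equals 2a^2 - a + 2dl, and solving the normal equations
with D = (1 - a)(1 + 2a) - dl gives
  Gamma_4^4 * D * (1 - b) = a dl^2 + (1 - a)(1 + 2a)(2dl - a(1 - a)),
  (Gamma_4^2 - Gamma_4^3) * D * (1 - b)
    = dl ((1 + 2a)(1 - a)^2 + dl (2 + 6a - dl)).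
Both are positive once dl > 0, D > 0 and 2dl >= a(1 - a).  In terms of u and v,
D > 0 reads v > (u - 1)^2, that is 3^H + 1 > 4^H.  The first and third conditions
both follow from v (u + 8) <= 6u^2 + 3u, which is a chord inequality for the
function ln ((4 e^t + 1) / (e^t + 4)), concave for t >= 0, at t = (2H - 1) ln 2
between 0 and ln 2.
*)
Require Import Defs.
From mathcomp Require Import all_boot all_order all_algebra.
From mathcomp Require Import all_classical all_reals all_analysis.
From mathcomp Require Import measurable_realfun ring lra.
Set Implicit Arguments.
Unset Strict Implicit.
Unset Printing Implicit Defensive.
Import Order.TTheory GRing.Theory Num.Theory.
Import numFieldNormedType.Exports.
Local Open Scope classical_set_scope.
Local Open Scope ring_scope.

(** * Orthogonality of a conditional expectation residual to measurable functions *)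

Section orthogonality.
Context d (T : measurableType d) (R : realType).
Variables (mu : {measure set T -> \bar R}) (G : set (set T)).
Hypothesis mG : <<s G >> `<=` measurable.

Import HBSimple HBNNSimple.

Lemma measurable_fun_sub_sigma_algebra (f : T -> R) :
  measurable_fun [set: g_sigma_algebraType G] f -> measurable_fun [set: T] f.
Proof. by move=> mf _ A mA; apply: mG; exact: mf. Qed.

Variable W : T -> R.
Hypothesis iW : mu.-integrable setT (EFin \o W).
Hypothesis W0 : forall E, <<s G >> E -> (\int[mu]_(x in E) (W x)%:E = 0)%E.

(** The level sets of [h] lie in [<<s G >>], so expanding [h] over their indicators leaves integrals
    that vanish by [W0]. *)
Lemma integral_mul_nnsfun_eq0 (h : {nnsfun g_sigma_algebraType G >-> R}) :
  (\int[mu]_x (h x * W x)%:E = 0)%E.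
Proof.
have mh y : <<s G >> (h @^-1` [set y]).
  by rewrite -[_ @^-1` _]setTI; apply: (measurable_funP h).
have iE y : mu.-integrable setT (fun x => (\1_(h @^-1` [set y]) x * W x)%:E).
  have /(integrable_mkcond _ (mG (mh y))) :
      mu.-integrable (h @^-1` [set y]) (EFin \o W).
    by apply: (integrableS measurableT) => //; exact: mG.
  rewrite restrict_EFin patch_indic; apply: eq_integrable => // x _ /=.
  by rewrite mulrC.
under eq_integral => x _.
  rewrite fimfunEord mulr_suml -sumEFin.
  under eq_bigr do rewrite -mulrA EFinM.
  over.
rewrite integral_sum//= => [|i]; last exact: integrableZl.
rewrite big1// => i _; set c := nth _ _ _.
rewrite integralZl// -[RHS](mule0 c%:E); congr (_ * _)%E.
rewrite -[RHS](W0 (mh c)) [RHS]integral_mkcond.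
by rewrite restrict_EFin patch_indic; apply: eq_integral => x _ /=; rewrite mulrC.
Qed.

(** Dominated convergence: simple functions increase to [Z], and their products with [W] stay below
    the integrable |Z W|. *)
Let ge0_integral_mul_eq0 (Z : T -> R) : (forall x, 0 <= Z x) ->
  measurable_fun [set: g_sigma_algebraType G] Z ->
  mu.-integrable setT (EFin \o (Z \* W)) ->
  (\int[mu]_x (Z x * W x)%:E = 0)%E.
Proof.
move=> Z0 mZ iZW.
have mZE : measurable_fun [set: g_sigma_algebraType G] (EFin \o Z).
  exact/measurable_EFinP.
pose h := nnsfun_approx measurableT mZE.
have Z0E (x : T) : setT x -> (0 <= (EFin \o Z) x)%E by rewrite lee_fin.
have mW : measurable_fun setT W by apply/measurable_EFinP; case/integrableP: iW.
have [||||| _ _] := @dominated_convergence _ _ _ mu setT measurableT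
  (fun n x => (h n x * W x)%:E) (EFin \o (Z \* W)) (fun x => `|(Z x * W x)%:E|%E).
- move=> n; apply/measurable_EFinP; apply: measurable_funM => //.
  exact: measurable_fun_sub_sigma_algebra.
- by case/integrableP: iZW.
- apply: aeW => x _; rewrite /= EFinM; under eq_fun do rewrite EFinM.
  apply: cvgeZr => //.
  exact: (@cvg_nnsfun_approx _ _ _ _ measurableT _ mZE Z0E).
- exact: integrable_abse.
- apply: aeW => x n _; rewrite !EFinM !abseM lee_wpmul2r//.
  rewrite !gee0_abs ?lee_fin//.
  by rewrite /h nnsfun_approxE -lee_fin le_approx.
- under eq_fun do rewrite integral_mul_nnsfun_eq0.
  by move=> /(cvg_lim (@ereal_hausdorff R)); rewrite lim_cst.
Qed.

(** Stated for unbounded [Z], since the test functions will be Gaussian increments. Both parts of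
    [Z] are at most |Z|, so integrability of Z W passes to each of them. *)
Lemma integral_mul_eq0 (Z : T -> R) :
  measurable_fun [set: g_sigma_algebraType G] Z ->
  mu.-integrable setT (EFin \o (Z \* W)) ->
  (\int[mu]_x (Z x * W x)%:E = 0)%E.
Proof.
move=> mZ iZW.
have mW : measurable_fun setT W by apply/measurable_EFinP; case/integrableP: iW.
have iP (f : T -> R) : measurable_fun [set: g_sigma_algebraType G] f ->
    (forall x, 0 <= f x <= `|Z x|) -> mu.-integrable setT (EFin \o (f \* W)).
  move=> mf fZ; apply: (le_integrable measurableT _ _ iZW).
    apply/measurable_EFinP; apply: measurable_funM => //.
    exact: measurable_fun_sub_sigma_algebra.
  move=> x _; rewrite /= lee_fin !normrM ler_wpM2r//.
  by case/andP: (fZ x) => ? ?; rewrite ger0_norm.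
have ip : mu.-integrable setT (EFin \o (Z^\+ \* W))%R.
  apply: iP; first exact: measurable_funrpos.
  by move=> x; rewrite funrpos_ge0/= /funrpos ge_max ler_norm normr_ge0.
have iN : mu.-integrable setT (EFin \o (Z^\- \* W))%R.
  apply: iP; first exact: measurable_funrneg.
  by move=> x; rewrite funrneg_ge0/= /funrneg ge_max -normrN ler_norm normr_ge0.
transitivity (\int[mu]_x ((Z^\+ x * W x)%:E - (Z^\- x * W x)%:E))%E.
  apply: eq_integral => x _; rewrite -EFinB -mulrBl; congr (_ * _)%:E.
  by rewrite -[in LHS](funrposBneg Z).
rewrite integralB_EFin// !ge0_integral_mul_eq0 ?subee//.
- exact: measurable_funrneg.
- exact: measurable_funrpos.
Qed.

End orthogonality.

(** * A chord inequality between powers of 2 and 3 *)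

Lemma pow3_le_pow2_frac (R : realType) (p : R) : 0 <= p <= 1 ->
  3 `^ p * (2 `^ p + 4) <= 2 `^ p * (4 * 2 `^ p + 1).
Proof.
move=> /andP[p0 p1].
(* [f] is minus the concave logarithm, hence convex for t >= 0; [g] is its derivative after
   simplification. *)
pose f (t : R) : R^o := ln (expR t + 4) - ln (4 * expR t + 1).
pose g (t : R) : R^o := (4 * expR t + 1)^-1 - 4 * (expR t + 4)^-1.
have f1 (t : R) : 0 < expR t + 4 by rewrite addr_gt0 ?expR_gt0.
have f2 (t : R) : 0 < 4 * expR t + 1 by rewrite addr_gt0// mulr_gt0 ?expR_gt0.
have df (t : R) : is_derive t 1 f (g t).
  have := f1 t; have := f2 t => ? ?.
  have d1 : is_derive (expR t + 4) 1 (@ln R) (expR t + 4)^-1 by exact: is_derive1_ln.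
  have d2 : is_derive (4 * expR t + 1) 1 (@ln R) (4 * expR t + 1)^-1
    by exact: is_derive1_ln.
  have d3 : is_derive t 1 (fun t => ln (expR t + 4)) ((expR t + 4)^-1 * expR t).
    apply: (@is_derive1_comp _ (@ln R) (fun t => expR t + 4)).
    by apply: is_derive_eq; rewrite addr0.
  have d4 : is_derive t 1 (fun t => ln (4 * expR t + 1))
      ((4 * expR t + 1)^-1 * (4 * expR t)).
    apply: (@is_derive1_comp _ (@ln R) (fun t => 4 * expR t + 1)).
    by apply: is_derive_eq; rewrite addr0.
  apply: is_derive_eq; rewrite /g; field; lra.
have dg (t : R) : is_derive t 1 g
    (4 * expR t / (expR t + 4) ^+ 2 - 4 * expR t / (4 * expR t + 1) ^+ 2).
  have := f1 t; have := f2 t => ? ?.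
  have d1 : is_derive t 1 (fun t => (expR t + 4)^-1 : R^o)
      (- (expR t + 4) ^- 2 *: expR t).
    apply: is_deriveV; first by rewrite gt_eqF.
    by apply: is_derive_eq; rewrite addr0.
  have d2 : is_derive t 1 (fun t => (4 * expR t + 1)^-1 : R^o)
      (- (4 * expR t + 1) ^- 2 *: (4 * expR t)).
    apply: is_deriveV; first by rewrite gt_eqF.
    by apply: is_derive_eq; rewrite addr0.
  apply: is_derive_eq; rewrite /GRing.scale/=; field; lra.
have cf (t : R) : {for t, continuous f}.
  by apply: differentiable_continuous; apply/derivable1_diffP; have [] := df t.
have Df : 'D_1 f = g by apply/funext => t; apply: derive_val.
have ln20 : 0 <= ln 2 :> R by rewrite ln_ge0// ler1n.
have : f (p * ln 2) <= p * f (ln 2) + (1 - p) * f 0.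
  have q0 : 0 <= 1 - p by lra.
  have q1 : 1 - p <= 1 by lra.
  have := @second_derivative_convex R f 0 (ln 2) _ _ _ _ _ (Itv01 q0 q1) ln20.
  rewrite !convRE /= /unstable.onem opprB addrCA subrr addr0 mulr0 add0r.
  rewrite [(1 - p) * _ + _]addrC; apply.
  (* Nonnegativity of the second derivative reduces to e^t + 4 <= 4 e^t + 1, which is where t >= 0
     enters. *)
  - rewrite Df => t /andP[/ltW t0 _]; rewrite (@derive_val _ _ _ _ _ _ _ (dg t)).
    rewrite subr_ge0 ler_wpM2l ?mulr_ge0 ?expR_ge0//.
    rewrite lef_pV2 ?posrE ?exprn_gt0// ler_sqr ?nnegrE; [|exact: ltW..].
    have : 1 <= expR t by rewrite -expR0 ler_expR.
    lra.
  - exact/cvg_at_left_filter/cf.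
  - exact/cvg_at_right_filter/cf.
  - by move=> t _; have [] := df t.
  - by rewrite Df => t _; have [] := dg t.
rewrite /f !lnK ?posrE// expR0.
have -> : expR (p * ln 2) = 2 `^ p.
  by rewrite /powR ifF//; apply/eqP; lra.
have A0 : 0 < 2 `^ p :> R by rewrite powR_gt0.
have B0 : 0 < 3 `^ p :> R by rewrite powR_gt0.
(* These factorizations give the endpoint values f(ln 2) = ln 2 - ln 3 and f(0) = 0. *)
have -> : 2 + 4 = 2 * 3 :> R by ring.
have -> : 4 * 2 + 1 = 3 * 3 :> R by ring.
have -> : 1 + 4 = 4 * 1 + 1 :> R by ring.
rewrite subrr mulr0 addr0 [ln (2 * 3)]lnM ?posrE// [ln (3 * 3)]lnM ?posrE// => h.
rewrite -ler_ln ?posrE ?mulr_gt0 ?addr_gt0 ?mulr_gt0//.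
rewrite !lnM ?posrE ?addr_gt0 ?mulr_gt0// !ln_powR; lra.
Qed.

(** * Autocovariances of the increments and the normal equations *)

Definition fgn_rho (R : realType) (H : R) (k : nat) : R :=
  2^-1 * (k.+1%:R `^ (2 * H) - 2 * k%:R `^ (2 * H) + `|k%:R - 1| `^ (2 * H)).

(** The right side is what bilinearity of the covariance yields for the increments over [j, j+1] and
    [k, k+1]. It is symmetric in [j] and [k], so j <= k may be assumed. *)
Lemma fgn_rhoE (R : realType) (H : R) (j k : nat) :
  fgn_rho H `|j - k|%N =
  2^-1 * (`|j.+1%:R - k%:R| `^ (2 * H) - 2 * `|j%:R - k%:R| `^ (2 * H)
          + `|j%:R - k.+1%:R| `^ (2 * H)).
Proof.
wlog jk : j k / (j <= k)%N => [th|].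
  have [/th//|/ltnW/th] := leqP j k.
  rewrite distnC => ->; congr (_ * _).
  rewrite addrAC [RHS]addrAC [X in X - _ = _]addrC.
  by rewrite (distrC k.+1%:R) (distrC k%:R) (distrC k%:R).
rewrite distnEr// /fgn_rho; set m := (k - j)%N.
have kE : k%:R = j%:R + m%:R :> R by rewrite -natrD subnKC.
have -> : j.+1%:R - k%:R = - (m%:R - 1) :> R by rewrite -natr1 kE; ring.
have -> : j%:R - k%:R = - m%:R :> R by rewrite kE; ring.
have -> : j%:R - k.+1%:R = - m.+1%:R :> R.
  by rewrite -natr1 kE -(natr1 m); ring.
by rewrite !normrN !normr_nat; ring.
Qed.

Section fbm.
Context d (T : measurableType d) (R : realType) (P : probability T R).
Variables (H : R) (B : R -> {RV P >-> R}).
Hypothesis fB : fractional_brownian_motion H B.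

(* The variance is an integral in the extended reals, so the finite value given
   by the covariance formula forces square integrability. *)
Lemma fbm_Lfun2 (t : R) : 0 <= t -> (B t : T -> R) \in Lfun P 2%:E.
Proof.
move=> t0; have [_ _ /(_ _ t0) E0 /(_ _ _ t0 t0)] := fB.
rewrite unlock E0 /= => cB.
rewrite inE; apply/andP; split; rewrite inE//=.
rewrite /finite_norm unlock /Lnorm.
apply: poweR_lty.
have : ('E_P[(B t \- cst 0%R) * (B t \- cst 0%R)] < +oo)%E by rewrite cB ltry.
rewrite unlock; apply: le_lt_trans; rewrite le_eqVlt; apply/orP; left; apply/eqP.
apply: eq_integral => x _ /=.
by rewrite [in RHS]/GRing.mul/= subr0 powR_mulrn// real_normK ?num_real// expr2.
Qed.

Lemma increment_Lfun2 (k : nat) : increment B k \in Lfun P 2%:E.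
Proof. by rewrite /increment rpredB//= ?lee1n// => ?; exact: fbm_Lfun2. Qed.

Lemma increment_Lfun1 (k : nat) : increment B k \in Lfun P 1.
Proof. by apply: Lfun_subset12 (increment_Lfun2 k); exact: fin_num_measure. Qed.

Lemma expectation_increment k : ('E_P[increment B k] = 0)%E.
Proof.
have B1 (t : R) : 0 <= t -> (B t : T -> R) \in Lfun P 1.
  by move=> /fbm_Lfun2; apply: Lfun_subset12; exact: fin_num_measure.
have [_ _ E0 _] := fB.
by rewrite expectationB ?B1// !E0// sube0.
Qed.

Lemma integral_increment_mul (j k : nat) :
  (\int[P]_x (increment B j.+1 x * increment B k.+1 x)%:E
    = (fgn_rho H `|j - k|%N)%:E)%E.
Proof.
have [_ _ _ cB] := fB.
have : covariance P (increment B j.+1) (increment B k.+1)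
    = (fgn_rho H `|j - k|%N)%:E.
  have B2 (i : nat) : (B i%:R : T -> R) \in Lfun P 2%:E by exact: fbm_Lfun2.
  rewrite covarianceBl//; last exact: increment_Lfun2.
  rewrite !covarianceBr// !cB// -!EFinB; congr _%:E; rewrite fgn_rhoE.
  have -> : j.+1%:R - k.+1%:R = j%:R - k%:R :> R by rewrite -!natr1; ring.
  by field.
rewrite covarianceE ?increment_Lfun1//; last first.
  by apply: Lfun2_mul_Lfun1; exact: increment_Lfun2.
by rewrite !expectation_increment mule0 sube0 unlock.
Qed.

Lemma sigma_increments_measurable n :
  sigma_increments B n `<=` (measurable : set (set T)).
Proof.
apply: smallest_sub; first exact: sigma_algebra_measurable.
elim/big_ind: _ => [//|C D mC mD|i _]; first by rewrite subUset.
move=> _ [A mA <-]; rewrite setTI.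
have : measurable_fun setT (increment B i.+2) by exact: measurable_funB.
by move=> /(_ measurableT _ mA); rewrite setTI.
Qed.

(** The residual Y - Delta_1 integrates to 0 over every event of the sigma-algebra, hence also
    against Delta_{l+1}. The index [l] is thus one less than in the usual form of the system. *)
Lemma normal_equation n (Gamma : nat -> R) (l : nat) :
  projection_coefficients B n Gamma -> (1 <= l < n)%N ->
  \sum_(2 <= k < n.+1) Gamma k * fgn_rho H `|l - k.-1|%N = fgn_rho H l.
Proof.
move=> [iX iY _ XY] ln.
pose G := \big[setU/set0]_(i < n.-1)
  preimage_set_system [set: T] (increment B i.+2) measurable.
have mG := @sigma_increments_measurable n.
have mZ : measurable_fun [set: g_sigma_algebraType G] (increment B l.+1).
  move=> _ A mA; apply: sub_sigma_algebra.
  (* The generators start at Delta_2, so Delta_{l+1} is the one of index l - 1; the bounds on [l]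
     make this index valid. *)
  case: l ln => // l; rewrite -ltn_predRL => ln.
  rewrite /G (bigD1 (Ordinal ln))//=; left; by exists A.
pose Y x := \sum_(2 <= k < n.+1) Gamma k * increment B k x.
have iZX : P.-integrable setT
    (fun x => (increment B l.+1 x * increment B 1 x)%:E).
  by apply/Lfun1_integrable/Lfun2_mul_Lfun1; exact: increment_Lfun2.
have EZY x : (increment B l.+1 x * Y x)%:E = (\sum_(2 <= k < n.+1)
    (Gamma k)%:E * (increment B l.+1 x * increment B k x)%:E)%E.
  rewrite mulr_sumr -sumEFin; apply: eq_bigr => k _.
  by rewrite -EFinM mulrCA.
have iZk k : P.-integrable setT
    (fun x => ((Gamma k)%:E * (increment B l.+1 x * increment B k x)%:E)%E).
  apply: integrableZl => //.
  by apply/Lfun1_integrable/Lfun2_mul_Lfun1; exact: increment_Lfun2.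
have iZY : P.-integrable setT (fun x => (increment B l.+1 x * Y x)%:E).
  under eq_fun do rewrite EZY.
  exact: integrable_sum.
have iW : P.-integrable setT (EFin \o (fun x => Y x - increment B 1 x)).
  rewrite [X in integrable _ _ X]
    (_ : _ = (EFin \o Y) \- (EFin \o increment B 1))%E//.
  exact: integrableB.
have W0 E : <<s G >> E ->
    (\int[P]_(x in E) (Y x - increment B 1 x)%:E = 0)%E.
  move=> GE; have mE := mG _ GE.
  have iS f : P.-integrable setT f -> P.-integrable E f.
    by apply: integrableS.
  under eq_integral do rewrite EFinB.
  rewrite integralB_EFin//; [|exact: iS..].
  rewrite XY// subee// integrable_fin_num//.
  exact: iS.
have iZW : P.-integrable setT
    (EFin \o (increment B l.+1 \* (fun x => Y x - increment B 1 x))).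
  have := integrableB measurableT iZY iZX; apply: eq_integrable => // x _ /=.
  by rewrite -EFinB [in RHS]mulrBr.
have := integral_mul_eq0 mG iW W0 mZ iZW.
under eq_integral do rewrite mulrBr EFinB.
rewrite integralB_EFin//.
under eq_integral do rewrite EZY.
rewrite integral_sum//=.
rewrite integral_increment_mul distn0.
rewrite (eq_big_nat _ _ (F2 := fun k => (Gamma k * fgn_rho H `|l - k.-1|%N)%:E)).
  by rewrite sumEFin -EFinB => -[] /eqP; rewrite subr_eq0 => /eqP.
move=> [//|k] _; rewrite integralZl ?integral_increment_mul//.
by apply/Lfun1_integrable/Lfun2_mul_Lfun1; exact: increment_Lfun2.
Qed.

End fbm.

(** * Signs of the solution of the three normal equations *)

Lemma normal_system_signs (R : realFieldType) (a dl x y z : R) :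
  let b := a - dl in let c := 2 * a ^+ 2 - a + 2 * dl in
  0 < a < 1 -> 0 < dl < (1 - a) * (1 + 2 * a) -> a * (1 - a) <= 2 * dl ->
  x + a * y + b * z = a -> a * x + y + a * z = b -> b * x + a * y + z = c ->
  y < x /\ 0 < z.
Proof.
move=> b c /andP[a0 a1] /andP[dl0 dlD] adl E1 E2 E3.
set D := (1 - a) * (1 + 2 * a) - dl.
have D0 : 0 < D by rewrite subr_gt0.
have B0 : 0 < 1 - b by rewrite /b; lra.
have DB0 : 0 < D * (1 - b) by rewrite mulr_gt0.
have e1 : x + a * y + b * z - a = 0 by rewrite E1 subrr.
have e2 : a * x + y + a * z - b = 0 by rewrite E2 subrr.
have e3 : b * x + a * y + z - c = 0 by rewrite E3 subrr.
(* In both identities the extra terms are the combination of the three equations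
   that eliminates the other unknowns: the sum and the difference of the first
   and third determine x + z and x - z. *)
have zE : z * (D * (1 - b)) = a * dl ^+ 2
    + (1 - a) * (1 + 2 * a) * (2 * dl - a * (1 - a)).
  rewrite -[RHS]addr0.
  transitivity (a * dl ^+ 2 + (1 - a) * (1 + 2 * a) * (2 * dl - a * (1 - a))
   + ((1 - b) * ((x + a * y + b * z - a) + (b * x + a * y + z - c)
         - 2 * a * (a * x + y + a * z - b))
      - D * ((x + a * y + b * z - a) - (b * x + a * y + z - c))) / 2).
    by rewrite /D /c /b; field.
  by rewrite e1 e2 e3 !(subr0, addr0, mulr0, mul0r).
have xyE : (x - y) * (D * (1 - b)) =
    dl * ((1 + 2 * a) * (1 - a) ^+ 2 + dl * (2 + 6 * a - dl)).
  rewrite -[RHS]addr0.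
  transitivity (dl * ((1 + 2 * a) * (1 - a) ^+ 2 + dl * (2 + 6 * a - dl))
   + (2^-1 + a) * (1 - b) * ((x + a * y + b * z - a) + (b * x + a * y + z - c)
         - 2 * a * (a * x + y + a * z - b))
     + D / 2 * ((x + a * y + b * z - a) - (b * x + a * y + z - c))
     - (a * x + y + a * z - b) * (D * (1 - b))).
    by rewrite /D /c /b; field.
  by rewrite e1 e2 e3 !(subr0, addr0, mulr0, mul0r).
split.
  suff : 0 < (x - y) * (D * (1 - b)) by rewrite pmulr_lgt0// subr_gt0.
  rewrite xyE.
  have a21 : 0 < 1 + 2 * a by lra.
  (* Since dl < (1 - a)(1 + 2a) = 1 + a - 2a^2, the difference exceeds 1 + 5a + 2a^2. *)
  have dl2 : 0 < 2 + 6 * a - dl by nra.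
  by rewrite mulr_gt0// addr_gt0 ?mulr_gt0 ?exprn_gt0// subr_gt0.
suff : 0 < z * (D * (1 - b)) by rewrite pmulr_lgt0.
have a1' : 0 <= (1 - a) * (1 + 2 * a) by apply: mulr_ge0; lra.
have adl' : 0 <= 2 * dl - a * (1 - a) by rewrite subr_ge0.
rewrite zE; apply: ltr_wpDr; first exact: mulr_ge0.
by rewrite mulr_gt0// exprn_gt0.
Qed.

(** * Bounds on the first two autocovariances *)

Lemma powR4_lt_powR3D1 (R : realType) (H : R) : 0 < H < 1 -> 4 `^ H < 3 `^ H + 1.
Proof.
move=> /andP[H0 H1].
(* After division by 4^H the claim is 1 < (3/4)^H + (1/4)^H. An exponent below 1 raises each base,
   and the bases sum to 1. *)
have e3 : 3 `^ H = 4 `^ H * (3 / 4) `^ H.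
  by rewrite -powRM//; congr (_ `^ _); field.
have e1 : 1 = 4 `^ H * (1 / 4) `^ H.
  by rewrite -powRM// mulrC divfK// powR1.
have h1 : 1 / 4 <= (1 / 4) `^ H by apply: ger1_powR; lra.
have h3 : 3 / 4 < (3 / 4) `^ H.
  rewrite -ltr_ln ?posrE ?powR_gt0//.
  rewrite ln_powR ltr_nMl// ln_lt0//; lra.
rewrite e3 [X in _ < _ + X]e1 -mulrDr ltr_pMr ?powR_gt0//; lra.
Qed.

Lemma fgn_parameter_bounds (R : realType) (H : R) : 2^-1 < H < 1 ->
  let a := (2 `^ (2 * H) - 2) / 2 in
  let b := (3 `^ (2 * H) - 2 * 2 `^ (2 * H) + 1) / 2 in
  [/\ 0 < a < 1, 0 < a - b < (1 - a) * (1 + 2 * a) &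
      a * (1 - a) <= 2 * (a - b)].
Proof.
move=> /andP[H1 H2] a b.
have p01 : 0 <= 2 * H - 1 <= 1 by lra.
have A1 : 1 < 2 `^ (2 * H - 1).
  by rewrite -ltr_ln ?posrE ?powR_gt0// ln_powR ln1 mulr_gt0 ?ln_gt0//; lra.
have A2 : 2 `^ (2 * H - 1) < 2.
  rewrite -ltr_ln ?posrE ?powR_gt0// ln_powR gtr_pMl ?ln_gt0//; lra.
have := pow3_le_pow2_frac p01.
have E2 : 2 `^ (2 * H) = 2 * 2 `^ (2 * H - 1) by rewrite mulr_powRB1//; lra.
have E3 : 3 `^ (2 * H) = 3 * 3 `^ (2 * H - 1) by rewrite mulr_powRB1//; lra.
have H01 : 0 < H < 1 by lra.
have := powR4_lt_powR3D1 H01.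
have -> : 4 `^ H = 2 `^ (2 * H) :> R.
  by rewrite powRrM; congr (_ `^ _); rewrite -[2 in RHS]/(2%:R) powR_mulrn// -natrX.
have E3' : 3 `^ (2 * H) = (3 `^ H) ^+ 2.
  by rewrite mulrC powRrM -[2]/(2%:R) powR_mulrn.
move: E3'; rewrite /a /b E3 E2.
have : 0 < 3 `^ H by rewrite powR_gt0.
move: A1 A2.
move: (2 `^ _) (3 `^ (2 * H - 1)) (3 `^ H) => A V S A1 A2 S0 V3 AS VA.
(* With A = 2^(2H-1) and 3V = 3^(2H), a = A - 1 and this bound is a(1 - a) <= 2(a - b). Its right
   side equals 6A - 3 + (A - 1)(A - 2), which is below 6A - 3, so b < a follows too. *)
have VA' : 3 * V <= A ^+ 2 + 3 * A - 1.
  have A4 : 0 < A + 4 by lra.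
  rewrite -(ler_pM2r A4) -mulrA (le_trans (ler_wpM2l _ VA))//.
  rewrite -subr_ge0.
  have -> : (A ^+ 2 + 3 * A - 1) * (A + 4) - 3 * (A * (4 * A + 1))
      = (A - 1) * (A - 2) ^+ 2 by ring.
  by rewrite mulr_ge0 ?sqr_ge0 ?subr_ge0// ltW.
(* This is the upper bound on a - b, obtained by squaring 0 < 2A - 1 < S, where S = 3^H. *)
have VS : (2 * A - 1) ^+ 2 < 3 * V.
  rewrite V3; nra.
split; nra.
Qed.

Theorem proposition2p11 (d : measure_display) (T : measurableType d)
    (R : realType) (P : probability T R) (H : R) (B : R -> {RV P >-> R})
    (Gamma : nat -> R) :
  2^-1 < H < 1 ->
  fractional_brownian_motion H B ->
  projection_coefficients B 4 Gamma ->
  Gamma 2%N > Gamma 3%N /\ Gamma 4%N > 0.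
Proof.
move=> H12 fB pG.
have [a01 ab aab] := fgn_parameter_bounds H12.
(* The power 0^0 is 1 by convention, so the exponent must be shown nonzero. *)
have p0 : 0 `^ (2 * H) = 0 by rewrite powR0//; apply/eqP; lra.
have p1 : 1 `^ (2 * H) = 1 by rewrite powR1.
(* This makes rho_3 a polynomial in [a] and [b], leaving only two parameters. *)
have p4 : 4 `^ (2 * H) = (2 `^ (2 * H)) ^+ 2.
  by rewrite [RHS]expr2 -powRM//; congr (_ `^ _); ring.
set a := (_ - 2) / 2 in a01 ab aab; set b := (_ + 1) / 2 in ab aab.
have r0 : fgn_rho H 0 = 1.
  by rewrite /fgn_rho p0 sub0r normrN normr1 p1; field.
have r1 : fgn_rho H 1 = a.
  by rewrite /fgn_rho subrr normr0 p0 p1 /a; field.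
have r2 : fgn_rho H 2 = a - (a - b).
  have e : 2 - 1 = 1 :> R by ring.
  by rewrite /fgn_rho e normr1 p1 /a /b; field.
have r3 : fgn_rho H 3 = 2 * a ^+ 2 - a + 2 * (a - b).
  have e : 3 - 1 = 2 :> R by ring.
  by rewrite /fgn_rho e normr_nat p4 /a /b; field.
have E l : (1 <= l < 4)%N -> Gamma 2%N * fgn_rho H `|l - 1|%N +
    Gamma 3%N * fgn_rho H `|l - 2|%N + Gamma 4%N * fgn_rho H `|l - 3|%N =
    fgn_rho H l.
  by move=> /(normal_equation fB pG); rewrite unlock /= addr0 addrA.
have E1 : Gamma 2%N * fgn_rho H 0 + Gamma 3%N * fgn_rho H 1 +
  Gamma 4%N * fgn_rho H 2 = fgn_rho H 1 by exact: (E 1%N isT).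
have E2 : Gamma 2%N * fgn_rho H 1 + Gamma 3%N * fgn_rho H 0 +
  Gamma 4%N * fgn_rho H 1 = fgn_rho H 2 by exact: (E 2%N isT).
have E3 : Gamma 2%N * fgn_rho H 2 + Gamma 3%N * fgn_rho H 1 +
  Gamma 4%N * fgn_rho H 0 = fgn_rho H 3 by exact: (E 3%N isT).
rewrite r0 r1 r2 ?r3 in E1 E2 E3.
apply: (normal_system_signs a01 ab aab); lra.
Qed.
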